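(* Let $g=dr^2+f(r,\theta)^2\,d\theta^2$ be a Riemannian metric on $\mathbb{R}^2$ (written in polar coordinates $(r,\theta)$ about the origin) whose Gaussian curvature $K_g(r,\theta)=-\frac{f''(r,\theta)}{f(r,\theta)}$ is nonnegative everywhere. Let $u:\mathbb{R}^2\to\mathbb{R}$ be a harmonic function with respect to $g$, i.e. $\Delta_g u=0$. Suppose that for every $\delta>0$, \[ \liminf_{r\to\infty}\frac{M(u;r)}{r^{1+\delta}}=0 . \] Then $u$ has at most linear growth: there is a constant $C>0$ such that $|u(r,\theta)|\le C(1+r)$ for all $(r,\theta)$.
   Context: Here $f:(0,\infty)\times[0,2\pi]\to(0,\infty)$ is smooth with $f(r,0)=f(r,2\pi)$, $\lim_{r\to0^+}f(r,\theta)=0$ and $\lim_{r\to0^+}f'(r,\theta)=1$, where $'$ denotes $\partial/\partial r$; thus $g$ is a smooth metric on $\mathbb{R}^2$ for which polar coordinates about the origin are geodesic polar coordinates, and $r$ is the $g$-distance to the origin. The Laplacian of $g$ is \[ \Delta_g=\frac{\partial^2}{\partial r^2}+\frac{f'}{f}\frac{\partial}{\partial r}+\frac{1}{f^2}\frac{\partial^2}{\partial\theta^2}-\frac{f_\theta}{f^3}\frac{\partial}{\partial\theta},\qquad f_\theta=\frac{\partial f}{\partial\theta}. \] For a continuous function $v$, $M(v;r)=\sup_{\theta\in[0,2\pi)}|v(r,\theta)|$. *)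

(* Defs.v *)
From Stdlib Require Import Reals.
From Coquelicot Require Import Coquelicot.
Open Scope R_scope.

Definition d1 (h : R -> R -> R) : R -> R -> R :=
  fun x y => Derive (fun t => h t y) x.
Definition d2 (h : R -> R -> R) : R -> R -> R :=
  fun x y => Derive (fun t => h x t) y.

Fixpoint CkOn (k : nat) (D : R -> R -> Prop) (h : R -> R -> R) : Prop :=
  match k with
  | O => forall x y, D x y ->
           continuous (fun p : R * R => h (fst p) (snd p)) (x, y)
  | S k' => (forall x y, D x y ->
               continuous (fun p : R * R => h (fst p) (snd p)) (x, y) /\
               ex_derive (fun t => h t y) x /\ ex_derive (fun t => h x t) y)
            /\ CkOn k' D (d1 h) /\ CkOn k' D (d2 h)
  end.

Definition SmoothOn (D : R -> R -> Prop) (h : R -> R -> R) : Prop :=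
  forall k, CkOn k D h.

Definition pos_r : R -> R -> Prop := fun r _ => 0 < r.
Definition whole_plane : R -> R -> Prop := fun _ _ => True.

(* Hypotheses on the warping function f(r,theta) of g = dr^2 + f^2 dtheta^2
   (theta ranges over R, f being 2*PI-periodic in theta). *)
Definition polar_metric_fun (f : R -> R -> R) : Prop :=
  SmoothOn pos_r f /\
  (forall r th, 0 < r -> 0 < f r th) /\
  (forall r th, 0 < r -> f r (th + 2 * PI) = f r th) /\
  (forall th, filterlim (fun r => f r th) (at_right 0) (locally 0)) /\
  (forall th, filterlim (fun r => d1 f r th) (at_right 0) (locally 1)).

Definition gauss_curv (f : R -> R -> R) (r th : R) : R :=
  - d1 (d1 f) r th / f r th.

Definition polar (u : R -> R -> R) : R -> R -> R :=
  fun r th => u (r * cos th) (r * sin th).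

Definition lap_g (f v : R -> R -> R) (r th : R) : R :=
  d1 (d1 v) r th + d1 f r th / f r th * d1 v r th
  + / (f r th ^ 2) * d2 (d2 v) r th
  - d2 f r th / (f r th ^ 3) * d2 v r th.

(* M(v; r) = sup_theta |v(r,theta)| (v continuous and 2pi-periodic in theta,
   so the sup is finite). *)
Definition Mmax (v : R -> R -> R) (r : R) : R :=
  real (Lub_Rbar (fun y => exists th, 0 <= th < 2 * PI /\ y = Rabs (v r th))).

Definition liminf_pinfty_eq (h : R -> R) (l : R) : Prop :=
  (forall eps, 0 < eps -> exists R0, forall r, R0 < r -> l - eps < h r) /\
  (forall eps, 0 < eps -> forall R0, exists r, R0 < r /\ h r < l + eps).

(* Main.v *)
(** Write [v] for [u] in polar coordinates and [w = |grad v|^2].  In dimension two the Bochner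
    formula and the sharp Kato inequality read [Delta w = 4 H + 2 K w] and [|grad w|^2 = 4 H w],
    where [H] is the square of the Hessian of [v], so for [K >= 0] the function [log (1 + w)] is
    subharmonic.  On the other hand concavity of [f] gives [f' / f <= 1 / r], which makes [log r]
    superharmonic and [1 / r] strictly subharmonic.  By the maximum principle on annuli, a
    subharmonic function that is at most [A] on the unit circle and at most [A + eps log s] on
    arbitrarily large circles [r = s], for every [eps > 0], is bounded by [A].  Bernstein's
    gradient estimate turns the growth of [u] into such a bound for [log (1 + w)]; hence the
    gradient of [u] is bounded. *)

From Stdlib Require Import Reals ZArith Lra Classical IndefiniteDescription.
From Coquelicot Require Import Coquelicot.
Require Import Defs.
Open Scope R_scope.

(** * Smooth functions of two variables *)

Class open_2d (D : R -> R -> Prop) : Prop :=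
  open_2d_locally : forall x y, D x y -> locally_2d D x y.

#[local] Instance open_whole_plane : open_2d whole_plane.
Proof. intros x y _. apply locally_2d_forall. intros; exact I. Qed.

#[local] Instance open_pos_r : open_2d pos_r.
Proof.
  intros r th Hr. exists (mkposreal r Hr). simpl. intros p q Hp _.
  apply Rabs_def2 in Hp. unfold pos_r. lra.
Qed.

Lemma CkOn_subset (D E : R -> R -> Prop) k h :
  (forall x y, D x y -> E x y) -> CkOn k E h -> CkOn k D h.
Proof.
  intros HDE. revert h. induction k as [|k IH]; intros h Hh.
  - intros x y HD. apply Hh, HDE, HD.
  - destruct Hh as (Hreg & Hh1 & Hh2). split; [|split; auto].
    intros x y HD. apply Hreg, HDE, HD.
Qed.

Lemma CkOn_pred k D h : CkOn (S k) D h -> CkOn k D h.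
Proof.
  revert h. induction k as [|k IH]; intros h Hh.
  - intros x y HD. apply (proj1 Hh x y HD).
  - destruct Hh as (Hreg & Hh1 & Hh2). split; [exact Hreg | split; apply IH; assumption].
Qed.

Lemma CkOn_continuous k D h : CkOn k D h -> CkOn 0 D h.
Proof. induction k as [|k IH]; auto using CkOn_pred. Qed.

Lemma CkOn_is_derive_d1 k D h x y :
  CkOn (S k) D h -> D x y -> is_derive (fun t => h t y) x (d1 h x y).
Proof. intros [Hreg _] HD. apply Derive_correct, (Hreg x y HD). Qed.

Lemma CkOn_is_derive_d2 k D h x y :
  CkOn (S k) D h -> D x y -> is_derive (fun t => h x t) y (d2 h x y).
Proof. intros [Hreg _] HD. apply Derive_correct, (Hreg x y HD). Qed.

Section OpenDomain.

Context {D : R -> R -> Prop} {D_open : open_2d D}.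

Lemma open_locally_fst x y : D x y -> locally x (fun t => D t y).
Proof. intros HD. apply (locally_2d_1d_const_y D), open_2d_locally, HD. Qed.

Lemma open_locally_snd x y : D x y -> locally y (fun t => D x t).
Proof. intros HD. apply (locally_2d_1d_const_x D), open_2d_locally, HD. Qed.

Lemma d1_ext_on h g x y :
  (forall x y, D x y -> h x y = g x y) -> D x y -> d1 h x y = d1 g x y.
Proof.
  intros Heq HD. apply Derive_ext_loc.
  apply filter_imp with (2 := open_locally_fst x y HD). auto.
Qed.

Lemma d2_ext_on h g x y :
  (forall x y, D x y -> h x y = g x y) -> D x y -> d2 h x y = d2 g x y.
Proof.
  intros Heq HD. apply Derive_ext_loc.
  apply filter_imp with (2 := open_locally_snd x y HD). auto.
Qed.

Lemma continuous_on_ext h g :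
  (forall x y, D x y -> h x y = g x y) -> CkOn 0 D h -> CkOn 0 D g.
Proof.
  intros Heq Hh x y HD.
  apply (continuous_ext_loc _ (fun p : R * R => h (fst p) (snd p))); [| exact (Hh x y HD)].
  apply filter_imp with (2 := proj1 (locally_2d_locally _ _ _) (open_2d_locally x y HD)).
  intros p. apply Heq.
Qed.

Lemma CkOn_ext k h g :
  (forall x y, D x y -> h x y = g x y) -> CkOn k D h -> CkOn k D g.
Proof.
  revert h g. induction k as [|k IH]; intros h g Heq Hh; [exact (continuous_on_ext h g Heq Hh) |].
  assert (Hg0 := continuous_on_ext h g Heq (CkOn_continuous _ D h Hh)).
  destruct Hh as (Hreg & Hh1 & Hh2). split; [|split].
  - intros x y HD. destruct (Hreg x y HD) as (_ & Hd1 & Hd2).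
    split; [exact (Hg0 x y HD) | split].
    + apply ex_derive_ext_loc with (2 := Hd1).
      apply filter_imp with (2 := open_locally_fst x y HD). auto.
    + apply ex_derive_ext_loc with (2 := Hd2).
      apply filter_imp with (2 := open_locally_snd x y HD). auto.
  - apply IH with (2 := Hh1). intros x y. apply d1_ext_on, Heq.
  - apply IH with (2 := Hh2). intros x y. apply d2_ext_on, Heq.
Qed.

Lemma CkOn_S_intro k h h1 h2 :
  CkOn 0 D h ->
  (forall x y, D x y -> is_derive (fun t => h t y) x (h1 x y)) ->
  (forall x y, D x y -> is_derive (fun t => h x t) y (h2 x y)) ->
  CkOn k D h1 -> CkOn k D h2 -> CkOn (S k) D h.
Proof.
  intros Hc Hd1 Hd2 Hh1 Hh2. split; [|split].
  - intros x y HD. split; [exact (Hc x y HD) |].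
    split; eexists; [apply Hd1 | apply Hd2]; exact HD.
  - apply CkOn_ext with (2 := Hh1). intros x y HD. symmetry. apply is_derive_unique, Hd1, HD.
  - apply CkOn_ext with (2 := Hh2). intros x y HD. symmetry. apply is_derive_unique, Hd2, HD.
Qed.

Lemma CkOn_const k c : CkOn k D (fun _ _ => c).
Proof.
  revert c. induction k as [|k IH]; intros c.
  - intros x y _. apply continuous_const.
  - apply CkOn_S_intro with (h1 := fun _ _ => 0) (h2 := fun _ _ => 0); auto.
    + intros x y _. apply continuous_const.
    + intros x y _. apply @is_derive_const.
    + intros x y _. apply @is_derive_const.
Qed.

Lemma CkOn_fst k : CkOn k D (fun x _ => x).
Proof.
  destruct k as [|k].
  - intros x y _. apply continuous_fst.
  - apply CkOn_S_intro with (h1 := fun _ _ => 1) (h2 := fun _ _ => 0); try apply CkOn_const.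
    + intros x y _. apply continuous_fst.
    + intros x y _. apply @is_derive_id.
    + intros x y _. apply @is_derive_const.
Qed.

Lemma CkOn_snd k : CkOn k D (fun _ y => y).
Proof.
  destruct k as [|k].
  - intros x y _. apply continuous_snd.
  - apply CkOn_S_intro with (h1 := fun _ _ => 0) (h2 := fun _ _ => 1); try apply CkOn_const.
    + intros x y _. apply continuous_snd.
    + intros x y _. apply @is_derive_const.
    + intros x y _. apply @is_derive_id.
Qed.

Lemma CkOn_plus k h g : CkOn k D h -> CkOn k D g -> CkOn k D (fun x y => h x y + g x y).
Proof.
  revert h g. induction k as [|k IH]; intros h g Hh Hg.
  - intros x y HD.
    exact (continuous_plus (V := R_NormedModule) _ _ _ (Hh x y HD) (Hg x y HD)).
  - apply CkOn_S_intro with (h1 := fun x y => d1 h x y + d1 g x y)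
      (h2 := fun x y => d2 h x y + d2 g x y).
    + intros x y HD. apply CkOn_continuous in Hh, Hg.
      exact (continuous_plus (V := R_NormedModule) _ _ _ (Hh x y HD) (Hg x y HD)).
    + intros x y HD. apply @is_derive_plus; eapply CkOn_is_derive_d1; eauto.
    + intros x y HD. apply @is_derive_plus; eapply CkOn_is_derive_d2; eauto.
    + apply IH; [apply Hh | apply Hg].
    + apply IH; [apply Hh | apply Hg].
Qed.

Lemma CkOn_mult k h g : CkOn k D h -> CkOn k D g -> CkOn k D (fun x y => h x y * g x y).
Proof.
  revert h g. induction k as [|k IH]; intros h g Hh Hg.
  - intros x y HD.
    exact (continuous_mult (K := R_AbsRing) _ _ _ (Hh x y HD) (Hg x y HD)).
  - apply CkOn_S_intro with (h1 := fun x y => d1 h x y * g x y + h x y * d1 g x y)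
      (h2 := fun x y => d2 h x y * g x y + h x y * d2 g x y).
    + intros x y HD. apply CkOn_continuous in Hh, Hg.
      exact (continuous_mult (K := R_AbsRing) _ _ _ (Hh x y HD) (Hg x y HD)).
    + intros x y HD. apply (is_derive_mult (fun t => h t y) (fun t => g t y));
        [eapply CkOn_is_derive_d1; eauto .. | exact Rmult_comm].
    + intros x y HD. apply (is_derive_mult (fun t => h x t) (fun t => g x t));
        [eapply CkOn_is_derive_d2; eauto .. | exact Rmult_comm].
    + apply CkOn_plus; apply IH; try apply Hh; try apply Hg; apply CkOn_pred; assumption.
    + apply CkOn_plus; apply IH; try apply Hh; try apply Hg; apply CkOn_pred; assumption.
Qed.

Lemma CkOn_pow k n h : CkOn k D h -> CkOn k D (fun x y => h x y ^ n).
Proof.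
  intros Hh. induction n as [|n IH]; [apply (CkOn_const k 1) |].
  apply (CkOn_mult k h (fun x y => h x y ^ n)); assumption.
Qed.

Lemma continuous_on_comp g h :
  (forall x y, D x y -> continuous g (h x y)) -> CkOn 0 D h -> CkOn 0 D (fun x y => g (h x y)).
Proof.
  intros Hg Hh x y HD.
  exact (continuous_comp (fun p : R * R => h (fst p) (snd p)) g (x, y) (Hh x y HD) (Hg x y HD)).
Qed.

Lemma CkOn_S_comp k g g' h :
  (forall x y, D x y -> is_derive g (h x y) (g' (h x y))) ->
  CkOn (S k) D h -> CkOn k D (fun x y => g' (h x y)) -> CkOn (S k) D (fun x y => g (h x y)).
Proof.
  intros Hg Hh Hg'.
  apply CkOn_S_intro with (h1 := fun x y => d1 h x y * g' (h x y))
    (h2 := fun x y => d2 h x y * g' (h x y)).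
  - apply continuous_on_comp; [| eapply CkOn_continuous; eassumption].
    intros x y HD. apply (ex_derive_continuous (V := R_NormedModule)).
    exists (g' (h x y)). apply Hg, HD.
  - intros x y HD. apply (is_derive_comp g (fun t => h t y)); [apply Hg, HD |].
    eapply CkOn_is_derive_d1; eauto.
  - intros x y HD. apply (is_derive_comp g (fun t => h x t)); [apply Hg, HD |].
    eapply CkOn_is_derive_d2; eauto.
  - apply CkOn_mult; [apply Hh | exact Hg'].
  - apply CkOn_mult; [apply Hh | exact Hg'].
Qed.

Lemma CkOn_inv k h :
  (forall x y, D x y -> h x y <> 0) -> CkOn k D h -> CkOn k D (fun x y => / h x y).
Proof.
  intros Hn. induction k as [|k IH]; intros Hh.
  - apply continuous_on_comp; [| exact Hh]. intros x y HD.
    apply (ex_derive_continuous (V := R_NormedModule)). auto_derive; auto.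
  - apply CkOn_S_comp with (g := Rinv) (g' := fun t => -1 * (/ t * / t)).
    + intros x y HD. specialize (Hn x y HD). auto_derive; [exact Hn | field; exact Hn].
    + exact Hh.
    + apply CkOn_pred in Hh.
      apply CkOn_mult; [apply CkOn_const | apply CkOn_mult; apply IH, Hh].
Qed.

Lemma CkOn_ln k h :
  (forall x y, D x y -> 0 < h x y) -> CkOn k D h -> CkOn k D (fun x y => ln (h x y)).
Proof.
  intros Hpos Hh. destruct k as [|k].
  - apply continuous_on_comp; [| exact Hh]. intros x y HD.
    apply (ex_derive_continuous (V := R_NormedModule)). exists (/ h x y). apply is_derive_ln; auto.
  - apply CkOn_S_comp with (g' := Rinv); [| exact Hh |].
    + intros x y HD. apply is_derive_ln; auto.
    + apply CkOn_inv; [| apply CkOn_pred, Hh].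
      intros x y HD. apply Rgt_not_eq, Hpos, HD.
Qed.

Lemma CkOn_cos_sin k h :
  CkOn k D h -> CkOn k D (fun x y => cos (h x y)) /\ CkOn k D (fun x y => sin (h x y)).
Proof.
  induction k as [|k IH]; intros Hh.
  - split; apply continuous_on_comp; trivial; intros x y _;
      apply (ex_derive_continuous (V := R_NormedModule)); auto_derive; exact I.
  - destruct (IH (CkOn_pred k D h Hh)) as [IHcos IHsin]. split.
    + apply CkOn_S_comp with (g' := fun t => -1 * sin t); [| exact Hh |].
      * intros x y _. auto_derive; [exact I | ring].
      * apply CkOn_mult; [apply CkOn_const | exact IHsin].
    + apply CkOn_S_comp with (g' := cos); [| exact Hh | exact IHcos].
      intros x y _. auto_derive; [exact I | ring].
Qed.

Lemma is_derive_comp_2d (h : R -> R -> R) (p q : R -> R) (t p' q' : R) :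
  CkOn 1 D h -> D (p t) (q t) -> is_derive p t p' -> is_derive q t q' ->
  is_derive (fun t => h (p t) (q t)) t (d1 h (p t) (q t) * p' + d2 h (p t) (q t) * q').
Proof.
  intros Hh HD Hp Hq. apply is_derive_Reals.
  apply derivable_pt_lim_comp_2d; [| now apply is_derive_Reals ..].
  apply filterdiff_differentiable_pt_lim, (is_derive_filterdiff h (p t) (q t) (d1 h)).
  - apply filter_imp with (2 := proj1 (locally_2d_locally _ _ _) (open_2d_locally _ _ HD)).
    intros z. apply (CkOn_is_derive_d1 0), Hh.
  - apply (CkOn_is_derive_d2 0 D); assumption.
  - exact (proj1 (proj2 Hh) _ _ HD).
Qed.

Lemma d1_d2_commute k h x y : CkOn (S (S k)) D h -> D x y -> d1 (d2 h) x y = d2 (d1 h) x y.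
Proof.
  intros (Hreg & Hh1 & Hh2) HD. apply Schwarz.
  - apply locally_2d_impl with (2 := open_2d_locally x y HD).
    apply locally_2d_forall. intros p q Hpq.
    destruct (Hreg p q Hpq) as (_ & Hd1 & Hd2).
    split; [exact Hd1 | split; [exact Hd2 |]].
    split; [apply (proj1 Hh2 p q Hpq) | apply (proj1 Hh1 p q Hpq)].
  - apply continuity_2d_pt_filterlim.
    apply (CkOn_continuous k D (d1 (d2 h))); [apply Hh2 | exact HD].
  - apply continuity_2d_pt_filterlim.
    apply (CkOn_continuous k D (d2 (d1 h))); [apply Hh1 | exact HD].
Qed.

End OpenDomain.

Lemma CkOn_comp_2d k (D E : R -> R -> Prop) {D_open : open_2d D} {E_open : open_2d E} h p q :
  (forall x y, D x y -> E (p x y) (q x y)) ->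
  CkOn k E h -> CkOn k D p -> CkOn k D q -> CkOn k D (fun x y => h (p x y) (q x y)).
Proof.
  intros HDE.
  assert (Hcont : forall h, CkOn 0 E h -> CkOn 0 D p -> CkOn 0 D q ->
    CkOn 0 D (fun x y => h (p x y) (q x y))).
  { intros g Hg Hp Hq x y Hxy.
    apply (continuous_comp_2 (fun z : R * R => p (fst z) (snd z))
      (fun z : R * R => q (fst z) (snd z)) g); [apply Hp, Hxy | apply Hq, Hxy |].
    apply Hg, HDE, Hxy. }
  revert h. induction k as [|k IH]; intros h Hh Hp Hq; [apply Hcont; assumption |].
  assert (Hh_C1 : CkOn 1 E h).
  { clear - Hh. induction k as [|k IH]; auto using CkOn_pred. }
  assert (IHg : forall g, CkOn k E g -> CkOn k D (fun x y => g (p x y) (q x y))).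
  { intros g Hg. apply IH; auto using CkOn_pred. }
  apply CkOn_S_intro with
    (h1 := fun x y => d1 h (p x y) (q x y) * d1 p x y + d2 h (p x y) (q x y) * d1 q x y)
    (h2 := fun x y => d1 h (p x y) (q x y) * d2 p x y + d2 h (p x y) (q x y) * d2 q x y).
  - apply Hcont; eapply CkOn_continuous; eassumption.
  - intros x y Hxy. apply (is_derive_comp_2d h (fun t => p t y) (fun t => q t y));
      [assumption | apply HDE, Hxy | eapply CkOn_is_derive_d1; eauto ..].
  - intros x y Hxy. apply (is_derive_comp_2d h (fun t => p x t) (fun t => q x t));
      [assumption | apply HDE, Hxy | eapply CkOn_is_derive_d2; eauto ..].
  - destruct Hh as (_ & Hd1 & Hd2), Hp as (_ & Hp1 & _), Hq as (_ & Hq1 & _).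
    apply CkOn_plus; trivial; apply CkOn_mult; auto.
  - destruct Hh as (_ & Hd1 & Hd2), Hp as (_ & _ & Hp2), Hq as (_ & _ & Hq2).
    apply CkOn_plus; trivial; apply CkOn_mult; auto.
Qed.

(** * Maxima on rectangles and annuli *)

Definition rectangle (a b c d x y : R) : Prop := a <= x <= b /\ c <= y <= d.

Definition annulus (a b r th : R) : Prop := a <= r <= b.

Definition periodic_on (D : R -> R -> Prop) (h : R -> R -> R) : Prop :=
  forall r th, D r th -> h r (th + 2 * PI) = h r th.

Lemma periodic_on_d1 h : periodic_on pos_r h -> periodic_on pos_r (d1 h).
Proof.
  intros Hp r th Hr. apply Derive_ext_loc.
  apply filter_imp with (2 := open_locally_fst r th Hr). intros t. apply Hp.
Qed.

Lemma periodic_on_d2 h : periodic_on pos_r h -> periodic_on pos_r (d2 h).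
Proof.
  intros Hp r th Hr. unfold d2, Derive. f_equal. apply Lim_ext. intros e.
  rewrite <- (Hp r (th + e) Hr), <- (Hp r th Hr). f_equal. f_equal. f_equal. ring.
Qed.

Lemma rectangle_positive_lower_bound a b c d h :
  CkOn 0 (rectangle a b c d) h -> (forall x y, rectangle a b c d x y -> 0 < h x y) ->
  exists e, 0 < e /\ forall x y, rectangle a b c d x y -> e <= h x y.
Proof.
  intros Hc Hpos.
  destruct (functional_choice (fun (p : R * R) (e : posreal) =>
    rectangle a b c d (fst p) (snd p) -> e <= h (fst p) (snd p) / 2 /\
    forall x y, Rabs (x - fst p) < e -> Rabs (y - snd p) < e ->
      h (fst p) (snd p) / 2 < h x y)) as [delta Hdelta].
  { intros [p q]. destruct (classic (rectangle a b c d p q)) as [Hpq | Hn];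
      [| exists (mkposreal 1 Rlt_0_1); tauto].
    assert (Hhalf : 0 < h p q / 2) by (specialize (Hpos p q Hpq); lra).
    destruct (proj2 (continuity_2d_pt_filterlim h p q) (Hc p q Hpq) (mkposreal _ Hhalf))
      as [e He].
    exists (mkposreal (Rmin e (h p q / 2)) (Rmin_pos _ _ (cond_pos e) Hhalf)). simpl.
    intros _. split; [apply Rmin_r |]. intros x y Hx Hy.
    assert (Hdist : Rabs (h x y - h p q) < h p q / 2).
    { apply He; eapply Rlt_le_trans; eauto; apply Rmin_l. }
    apply Rabs_def2 in Hdist. lra. }
  destruct (compactness_value_2d a b c d (fun x y => delta (x, y))) as [e He].
  exists e. split; [apply cond_pos |]. intros x y [Hx Hy].
  apply Rnot_lt_le. intros Hlt. apply (He x y Hx Hy). intros (p & q & Hp & Hq & Hxp & Hyq & Hle).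
  destruct (Hdelta (p, q) (conj Hp Hq)) as [Hhalf Hnear]. simpl in *.
  specialize (Hnear x y Hxp Hyq). lra.
Qed.

Lemma rectangle_bounded a b c d h :
  CkOn 0 (rectangle a b c d) h ->
  exists B, forall x y, rectangle a b c d x y -> Rabs (h x y) <= B.
Proof.
  intros Hc.
  assert (Hpos : forall t, 0 < 1 + Rabs t) by (intros t; generalize (Rabs_pos t); lra).
  destruct (rectangle_positive_lower_bound a b c d (fun x y => / (1 + Rabs (h x y))))
    as (e & He & Hle).
  - apply (continuous_on_comp (fun t => / (1 + Rabs t))); [| exact Hc]. intros x y _.
    apply continuity_pt_filterlim, continuity_pt_inv; [| apply Rgt_not_eq, Hpos].
    apply continuity_pt_plus; [apply continuity_pt_const; now intros ? ? | apply Rcontinuity_abs].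
  - intros x y _. apply Rinv_0_lt_compat, Hpos.
  - exists (/ e). intros x y Hxy. specialize (Hle x y Hxy).
    apply Rinv_le_contravar in Hle; [| exact He]. rewrite Rinv_inv in Hle.
    lra.
Qed.

Lemma rectangle_max a b c d h :
  a <= b -> c <= d -> CkOn 0 (rectangle a b c d) h ->
  exists x0 y0, rectangle a b c d x0 y0 /\
    forall x y, rectangle a b c d x y -> h x y <= h x0 y0.
Proof.
  intros Hab Hcd Hc.
  set (values := fun z => exists x y, rectangle a b c d x y /\ z = h x y).
  destruct (completeness values) as [S [Hub Hleast]].
  { destruct (rectangle_bounded a b c d h Hc) as [B HB].
    exists B. intros z (x & y & Hxy & ->).
    eapply Rle_trans; [apply Rle_abs | auto]. }
  { exists (h a c), a, c. repeat split; lra. }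
  assert (HS : forall x y, rectangle a b c d x y -> h x y <= S).
  { intros x y Hxy. apply Hub. exists x, y. auto. }
  apply NNPP. intros Hnot_attained.
  destruct (rectangle_positive_lower_bound a b c d (fun x y => S - h x y)) as (e & He & Hle).
  - apply (continuous_on_comp (fun t => S - t)); [| exact Hc]. intros x y _.
    apply (ex_derive_continuous (V := R_NormedModule)). auto_derive; exact I.
  - intros x y Hxy. destruct (HS x y Hxy) as [Hlt | Heq]; [lra |].
    exfalso. apply Hnot_attained. exists x, y. rewrite Heq. auto.
  - assert (S <= S - e); [| lra].
    apply Hleast. intros z (x & y & Hxy & ->). specialize (Hle x y Hxy). lra.
Qed.

Lemma periodic_fundamental_domain (g : R -> R) (T t : R) :
  0 < T -> (forall t, g (t + T) = g t) -> exists t', 0 <= t' < T /\ g t = g t'.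
Proof.
  intros HT Hg.
  assert (Hg_Z : forall z t, g (t + IZR z * T) = g t).
  { induction z as [|z IH|z IH] using Z.peano_ind; intros s.
    - f_equal. ring.
    - rewrite succ_IZR, <- (IH s), <- (Hg (s + IZR z * T)). f_equal. ring.
    - rewrite <- (IH s), <- (Hg (s + _)). unfold Z.pred. rewrite plus_IZR. f_equal. ring. }
  exists (frac_part (t / T) * T).
  destruct (base_fp (t / T)) as [Hge0 Hlt1]. split; [split; nra |].
  rewrite <- (Hg_Z (Int_part (t / T)) (frac_part _ * T)). f_equal.
  rewrite <- Rmult_plus_distr_r, (Rplus_comm (frac_part _)), <- Rplus_Int_part_frac_part.
  field. lra.
Qed.

Lemma annulus_fundamental_domain a b h r th :
  periodic_on (annulus a b) h -> annulus a b r th ->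
  exists th', 0 <= th' < 2 * PI /\ h r th = h r th'.
Proof.
  intros Hp Hr. apply (periodic_fundamental_domain (h r)).
  - generalize PI_RGT_0. lra.
  - intros t. apply Hp, Hr.
Qed.

Lemma annulus_max a b h :
  a <= b -> CkOn 0 (annulus a b) h -> periodic_on (annulus a b) h ->
  exists r0 th0, annulus a b r0 th0 /\ forall r th, annulus a b r th -> h r th <= h r0 th0.
Proof.
  intros Hab Hc Hp.
  destruct (rectangle_max a b 0 (2 * PI) h) as (r0 & th0 & [Hr0 _] & Hmax); trivial.
  { generalize PI_RGT_0; lra. }
  { apply CkOn_subset with (2 := Hc). intros r th [Hr _]. exact Hr. }
  exists r0, th0. split; [exact Hr0 |]. intros r th Hr.
  destruct (annulus_fundamental_domain a b h r th Hp Hr) as (th' & Hth' & ->).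
  apply Hmax. split; [exact Hr | lra].
Qed.

Lemma annulus_bounded a b h :
  CkOn 0 (annulus a b) h -> periodic_on (annulus a b) h ->
  exists B, 0 <= B /\ forall r th, annulus a b r th -> Rabs (h r th) <= B.
Proof.
  intros Hc Hp.
  destruct (rectangle_bounded a b 0 (2 * PI) h) as [B HB].
  { apply CkOn_subset with (2 := Hc). intros r th [Hr _]. exact Hr. }
  exists (Rabs B). split; [apply Rabs_pos |]. intros r th Hr.
  destruct (annulus_fundamental_domain a b h r th Hp Hr) as (th' & Hth' & ->).
  apply Rle_trans with B; [apply HB; split; [exact Hr | lra] | apply Rle_abs].
Qed.

Lemma Mmax_ge v r th :
  CkOn 0 (annulus r r) v -> periodic_on (annulus r r) v -> Rabs (v r th) <= Mmax v r.
Proof.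
  intros Hc Hp. assert (Hr : annulus r r r th) by (split; lra).
  destruct (annulus_bounded r r v Hc Hp) as (B & _ & HB).
  unfold Mmax. set (values := fun y => exists th, 0 <= th < 2 * PI /\ y = Rabs (v r th)).
  destruct (Lub_Rbar_correct values) as [Hub Hleast].
  destruct (annulus_fundamental_domain r r v r th Hp Hr) as (th0 & Hth0 & ->).
  assert (Hlow : Rbar_le (Rabs (v r th0)) (Lub_Rbar values)) by (apply Hub; exists th0; auto).
  assert (Hup : Rbar_le (Lub_Rbar values) B).
  { apply Hleast. intros y (t & _ & ->). apply HB. split; lra. }
  destruct (Lub_Rbar values) as [l| |]; simpl in *; tauto.
Qed.

(** * Calculus of one variable *)

Lemma is_derive_pos_increasing_right (g : R -> R) (x l b : R) :
  is_derive g x l -> 0 < l -> x < b -> exists y, x < y < b /\ forall t, x < t <= y -> g x < g t.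
Proof.
  intros Hg Hl Hxb. apply is_derive_Reals in Hg. destruct (Hg l Hl) as [d Hd].
  assert (Hd0 := cond_pos d).
  exists (x + Rmin (d / 2) ((b - x) / 2)).
  assert (Hmin : 0 < Rmin (d / 2) ((b - x) / 2)) by (apply Rmin_pos; lra).
  assert (Hmin_d := Rmin_l (d / 2) ((b - x) / 2)).
  assert (Hmin_b := Rmin_r (d / 2) ((b - x) / 2)).
  split; [lra |]. intros t Ht.
  assert (Hquot : Rabs ((g (x + (t - x)) - g x) / (t - x) - l) < l).
  { apply Hd; [lra |]. rewrite Rabs_pos_eq; lra. }
  replace (x + (t - x)) with t in Hquot by ring.
  apply Rabs_def2 in Hquot as [_ Hquot].
  assert (Hpos : 0 < (g t - g x) / (t - x) * (t - x)) by (apply Rmult_lt_0_compat; lra).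
  replace ((g t - g x) / (t - x) * (t - x)) with (g t - g x) in Hpos by (field; lra). lra.
Qed.

Lemma local_max_derivatives (g g1 : R -> R) (a b x l : R) :
  a < x < b -> (forall t, a < t < b -> is_derive g t (g1 t)) -> is_derive g1 x l ->
  (forall t, a < t < b -> g t <= g x) -> g1 x = 0 /\ l <= 0.
Proof.
  intros Hx Hg Hg1 Hmax.
  assert (Hcrit : g1 x = 0).
  { assert (pr : derivable_pt g x) by (exists (g1 x); apply is_derive_Reals, Hg, Hx).
    rewrite <- (is_derive_unique g x (g1 x)) by apply Hg, Hx. rewrite <- (Derive_Reals g x pr).
    apply (deriv_maximum g a b); [lra | lra | auto]. }
  split; [exact Hcrit |]. apply Rnot_lt_le. intros Hl.
  destruct (is_derive_pos_increasing_right g1 x l b Hg1 Hl) as (y & Hy & Hincr); [lra |].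
  destruct (MVT_cor2 g g1 x y) as (c & Hc & Hcxy); [lra | |].
  { intros c Hc. apply is_derive_Reals, Hg. lra. }
  assert (Hc_pos := Hincr c ltac:(lra)). assert (Hy_max := Hmax y ltac:(lra)). nra.
Qed.

Lemma concave_below_tangent (g g1 g2 : R -> R) (a b : R) :
  a < b -> (forall t, a <= t <= b -> is_derive g t (g1 t)) ->
  (forall t, a <= t <= b -> is_derive g1 t (g2 t)) -> (forall t, a <= t <= b -> g2 t <= 0) ->
  g a <= g b + g1 b * (a - b).
Proof.
  intros Hab Hg Hg1 Hg2.
  destruct (MVT_cor2 g g1 a b) as (c & Hc & Hcab); [lra | |].
  { intros t Ht. apply is_derive_Reals, Hg, Ht. }
  destruct (MVT_cor2 g1 g2 c b) as (c' & Hc' & Hccb); [lra | |].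
  { intros t Ht. apply is_derive_Reals, Hg1. lra. }
  assert (Hdecr := Hg2 c' ltac:(lra)).
  assert (g1 b <= g1 c) by nra. nra.
Qed.

Lemma pos_concave_slope (g g1 g2 : R -> R) (r : R) :
  (forall t, 0 < t -> is_derive g t (g1 t)) -> (forall t, 0 < t -> is_derive g1 t (g2 t)) ->
  (forall t, 0 < t -> g2 t <= 0) -> (forall t, 0 < t -> 0 < g t) -> 0 < r ->
  r * g1 r <= g r.
Proof.
  intros Hg Hg1 Hg2 Hpos Hr.
  destruct (Rle_lt_dec (g1 r) 0) as [Hneg | Hslope]; [specialize (Hpos r Hr); nra |].
  apply Rle_plus_epsilon. intros eps Heps.
  set (e := Rmin (r / 2) (eps / g1 r)).
  assert (He : 0 < e) by (apply Rmin_pos; [lra | apply Rdiv_lt_0_compat; assumption]).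
  assert (Her : e <= r / 2) by apply Rmin_l.
  assert (Heg : e * g1 r <= eps).
  { replace eps with (eps / g1 r * g1 r) by (field; lra).
    apply Rmult_le_compat_r; [lra | apply Rmin_r]. }
  assert (Htangent := concave_below_tangent g g1 g2 e r ltac:(lra)
    (fun t Ht => Hg t ltac:(lra)) (fun t Ht => Hg1 t ltac:(lra)) (fun t Ht => Hg2 t ltac:(lra))).
  specialize (Hpos e He). lra.
Qed.

Lemma Rpower_div_self_sqr_le s delta :
  4 <= s -> 0 <= delta -> (Rpower s (1 + delta) / s) ^ 2 <= Rpower (s / 2) (4 * delta).
Proof.
  intros Hs Hdelta.
  replace (Rpower s (1 + delta) / s) with (Rpower s delta)
    by (rewrite Rpower_plus, Rpower_1 by lra; field; lra).
  replace (Rpower s delta ^ 2) with (Rpower s (2 * delta))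
    by (rewrite <- Rpower_pow, Rpower_mult by apply exp_pos; f_equal; simpl; ring).
  replace (4 * delta) with (INR 2 * (2 * delta)) by (simpl; ring).
  rewrite <- (Rpower_mult (s / 2)), Rpower_pow by lra. apply Rle_Rpower_l; nra.
Qed.

Lemma quadratic_form_ge0 a b c x y :
  0 <= a -> 0 <= c -> b ^ 2 <= a * c -> 0 <= a * x ^ 2 + 2 * b * (x * y) + c * y ^ 2.
Proof.
  intros Ha Hc Hdisc. destruct Ha as [Ha | <-].
  - apply (Rmult_le_reg_l a); [exact Ha |]. rewrite Rmult_0_r.
    replace (a * _) with ((a * x + b * y) ^ 2 + (a * c - b ^ 2) * y ^ 2) by ring.
    assert (0 <= (a * c - b ^ 2) * y ^ 2) by (apply Rmult_le_pos; [lra | apply pow2_ge_0]).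
    assert (0 <= (a * x + b * y) ^ 2) by apply pow2_ge_0. lra.
  - assert (b = 0) as -> by nra. assert (0 <= y ^ 2) by apply pow2_ge_0. nra.
Qed.

(** * Derivations of smooth functions *)

Record derivation (D : R -> R -> Prop) (X : (R -> R -> R) -> R -> R -> R) : Prop := {
  derivation_smooth : forall h, SmoothOn D h -> SmoothOn D (X h);
  derivation_ext : forall h g,
    (forall x y, D x y -> h x y = g x y) -> forall x y, D x y -> X h x y = X g x y;
  derivation_plus : forall h g, SmoothOn D h -> SmoothOn D g ->
    forall x y, D x y -> X (fun x y => h x y + g x y) x y = X h x y + X g x y;
  derivation_mult : forall h g, SmoothOn D h -> SmoothOn D g ->
    forall x y, D x y -> X (fun x y => h x y * g x y) x y = X h x y * g x y + h x y * X g x y;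
  derivation_comp : forall g g' h, SmoothOn D h ->
    (forall x y, D x y -> is_derive g (h x y) (g' (h x y))) ->
    forall x y, D x y -> X (fun x y => g (h x y)) x y = g' (h x y) * X h x y }.

Arguments derivation_smooth {D X}.
Arguments derivation_ext {D X}.
Arguments derivation_plus {D X}.
Arguments derivation_mult {D X}.
Arguments derivation_comp {D X}.

Lemma derivation_d1 (D : R -> R -> Prop) {D_open : open_2d D} : derivation D d1.
Proof.
  split.
  - intros h Hh k. apply (Hh (S k)).
  - intros h g Heq x y. apply d1_ext_on, Heq.
  - intros h g Hh Hg x y HD.
    apply (Derive_plus (fun t => h t y) (fun t => g t y));
      [apply (proj1 (Hh 1%nat) x y HD) | apply (proj1 (Hg 1%nat) x y HD)].
  - intros h g Hh Hg x y HD.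
    apply (Derive_mult (fun t => h t y) (fun t => g t y));
      [apply (proj1 (Hh 1%nat) x y HD) | apply (proj1 (Hg 1%nat) x y HD)].
  - intros g g' h Hh Hg x y HD. rewrite Rmult_comm. apply is_derive_unique.
    apply (is_derive_comp g (fun t => h t y)); [apply Hg, HD |].
    apply (CkOn_is_derive_d1 0 D h x y (Hh 1%nat) HD).
Qed.

Lemma derivation_d2 (D : R -> R -> Prop) {D_open : open_2d D} : derivation D d2.
Proof.
  split.
  - intros h Hh k. apply (Hh (S k)).
  - intros h g Heq x y. apply d2_ext_on, Heq.
  - intros h g Hh Hg x y HD.
    apply (Derive_plus (fun t => h x t) (fun t => g x t));
      [apply (proj1 (Hh 1%nat) x y HD) | apply (proj1 (Hg 1%nat) x y HD)].
  - intros h g Hh Hg x y HD.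
    apply (Derive_mult (fun t => h x t) (fun t => g x t));
      [apply (proj1 (Hh 1%nat) x y HD) | apply (proj1 (Hg 1%nat) x y HD)].
  - intros g g' h Hh Hg x y HD. rewrite Rmult_comm. apply is_derive_unique.
    apply (is_derive_comp g (fun t => h x t)); [apply Hg, HD |].
    apply (CkOn_is_derive_d2 0 D h x y (Hh 1%nat) HD).
Qed.

Lemma derivation_scal (D : R -> R -> Prop) {D_open : open_2d D} X p :
  SmoothOn D p -> derivation D X -> derivation D (fun h x y => p x y * X h x y).
Proof.
  intros Hp HX. split.
  - intros h Hh k. apply CkOn_mult; [apply Hp | apply (derivation_smooth HX h Hh)].
  - intros h g Heq x y HD. f_equal. apply (derivation_ext HX); assumption.
  - intros h g Hh Hg x y HD. rewrite (derivation_plus HX h g Hh Hg x y HD). ring.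
  - intros h g Hh Hg x y HD. rewrite (derivation_mult HX h g Hh Hg x y HD). ring.
  - intros g g' h Hh Hg x y HD. rewrite (derivation_comp HX g g' h Hh Hg x y HD). ring.
Qed.

Lemma derivation_inv (D : R -> R -> Prop) X h x y :
  derivation D X -> SmoothOn D h -> (forall x y, D x y -> h x y <> 0) -> D x y ->
  X (fun x y => / h x y) x y = - / h x y ^ 2 * X h x y.
Proof.
  intros HX Hh Hn HD. apply (derivation_comp HX Rinv (fun t => - / t ^ 2)); trivial.
  intros p q Hpq. specialize (Hn p q Hpq). auto_derive; [exact Hn | field; exact Hn].
Qed.

Section SecondOrderRules.

Context {D : R -> R -> Prop} {D_open : open_2d D} {X : (R -> R -> R) -> R -> R -> R}.
Hypothesis X_der : derivation D X.

Lemma derivation2_plus h g x y : SmoothOn D h -> SmoothOn D g -> D x y ->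
  X (X (fun x y => h x y + g x y)) x y = X (X h) x y + X (X g) x y.
Proof.
  intros Hh Hg HD.
  rewrite <- (derivation_plus X_der) by (trivial; apply (derivation_smooth X_der); trivial).
  apply (derivation_ext X_der); [| exact HD]. apply (derivation_plus X_der); trivial.
Qed.

Lemma derivation2_mult h g x y : SmoothOn D h -> SmoothOn D g -> D x y ->
  X (X (fun x y => h x y * g x y)) x y
  = X (X h) x y * g x y + 2 * (X h x y * X g x y) + h x y * X (X g) x y.
Proof.
  intros Hh Hg HD.
  assert (HXh := derivation_smooth X_der h Hh). assert (HXg := derivation_smooth X_der g Hg).
  rewrite (derivation_ext X_der _ (fun x y => X h x y * g x y + h x y * X g x y))
    by (trivial; apply (derivation_mult X_der); trivial).
  rewrite (derivation_plus X_der (fun x y => X h x y * g x y))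
    by (trivial; intros k; apply CkOn_mult; auto).
  rewrite !(derivation_mult X_der) by trivial. ring.
Qed.

Lemma derivation2_comp (g g' g'' : R -> R) h x y :
  SmoothOn D h -> SmoothOn D (fun x y => g' (h x y)) ->
  (forall x y, D x y -> is_derive g (h x y) (g' (h x y))) ->
  (forall x y, D x y -> is_derive g' (h x y) (g'' (h x y))) -> D x y ->
  X (X (fun x y => g (h x y))) x y = g' (h x y) * X (X h) x y + g'' (h x y) * X h x y ^ 2.
Proof.
  intros Hh Hg'h Hg Hg' HD.
  rewrite (derivation_ext X_der _ (fun x y => g' (h x y) * X h x y))
    by (trivial; apply (derivation_comp X_der); trivial).
  rewrite (derivation_mult X_der (fun x y => g' (h x y)))
    by (trivial; apply (derivation_smooth X_der); trivial).
  rewrite (derivation_comp X_der g' g'') by trivial. ring.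
Qed.

End SecondOrderRules.

(** * The Laplacian in the moving frame *)

(* The unit tangential derivative: [d1] and [d_tan f] form an orthonormal frame of the metric. *)
Definition d_tan (f h : R -> R -> R) (r th : R) : R := / f r th * d2 h r th.

(* The geodesic curvature of the circle of radius [r], which is also the Laplacian of [r]. *)
Definition circle_curv (f : R -> R -> R) (r th : R) : R := d1 f r th * / f r th.

Definition grad_dot (f h g : R -> R -> R) (r th : R) : R :=
  d1 h r th * d1 g r th + d_tan f h r th * d_tan f g r th.

Definition grad_sq (f h : R -> R -> R) : R -> R -> R := grad_dot f h h.

Lemma grad_sq_ge0 f h r th : 0 <= grad_sq f h r th.
Proof. unfold grad_sq, grad_dot. nra. Qed.

Section WarpedMetric.

Variable f : R -> R -> R.
Hypothesis f_smooth : SmoothOn pos_r f.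
Hypothesis f_pos : forall r th, 0 < r -> 0 < f r th.

Lemma f_neq0 r th : 0 < r -> f r th <> 0.
Proof. intros Hr. apply Rgt_not_eq, f_pos, Hr. Qed.

Lemma SmoothOn_inv_f : SmoothOn pos_r (fun r th => / f r th).
Proof. intros k. apply CkOn_inv; [exact f_neq0 | apply f_smooth]. Qed.

Lemma derivation_d_tan : derivation pos_r (d_tan f).
Proof.
  apply (derivation_scal pos_r d2); [exact SmoothOn_inv_f | apply derivation_d2, open_pos_r].
Qed.

Lemma SmoothOn_d1 h : SmoothOn pos_r h -> SmoothOn pos_r (d1 h).
Proof. apply (derivation_smooth (derivation_d1 pos_r)). Qed.

Lemma SmoothOn_d_tan h : SmoothOn pos_r h -> SmoothOn pos_r (d_tan f h).
Proof. apply (derivation_smooth derivation_d_tan). Qed.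

Lemma SmoothOn_circle_curv : SmoothOn pos_r (circle_curv f).
Proof. intros k. apply CkOn_mult; [apply SmoothOn_d1, f_smooth | apply SmoothOn_inv_f]. Qed.

Lemma SmoothOn_grad_sq h : SmoothOn pos_r h -> SmoothOn pos_r (grad_sq f h).
Proof.
  intros Hh k. assert (Ha := SmoothOn_d1 h Hh). assert (Hb := SmoothOn_d_tan h Hh).
  apply CkOn_plus; apply CkOn_mult; auto.
Qed.

Lemma lap_frame h r th : SmoothOn pos_r h -> 0 < r ->
  lap_g f h r th
  = d1 (d1 h) r th + circle_curv f r th * d1 h r th + d_tan f (d_tan f h) r th.
Proof.
  intros Hh Hr. assert (Hd2 := derivation_d2 pos_r).
  assert (Heq : d2 (d_tan f h) r th
    = - / f r th ^ 2 * d2 f r th * d2 h r th + / f r th * d2 (d2 h) r th).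
  { rewrite <- (derivation_inv pos_r d2 f r th Hd2 f_smooth f_neq0 Hr).
    apply (derivation_mult Hd2 _ _ SmoothOn_inv_f (derivation_smooth Hd2 h Hh) r th Hr). }
  unfold lap_g, circle_curv. unfold d_tan at 1. rewrite Heq.
  field. apply f_neq0, Hr.
Qed.

Lemma riccati_circle_curv r th : 0 < r ->
  d1 (circle_curv f) r th = - gauss_curv f r th - circle_curv f r th ^ 2.
Proof.
  intros Hr. assert (Hd1 := derivation_d1 pos_r).
  unfold circle_curv at 1.
  rewrite (derivation_mult Hd1 _ _ (SmoothOn_d1 f f_smooth) SmoothOn_inv_f r th Hr).
  rewrite (derivation_inv pos_r d1 f r th Hd1 f_smooth f_neq0 Hr).
  unfold gauss_curv, circle_curv. field. apply f_neq0, Hr.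
Qed.

Lemma frame_commutator h r th : SmoothOn pos_r h -> 0 < r ->
  d1 (d_tan f h) r th = d_tan f (d1 h) r th - circle_curv f r th * d_tan f h r th.
Proof.
  intros Hh Hr. assert (Hd1 := derivation_d1 pos_r).
  unfold d_tan at 1.
  rewrite (derivation_mult Hd1 _ (d2 h) SmoothOn_inv_f) by
    (trivial; apply (derivation_smooth (derivation_d2 pos_r)), Hh).
  rewrite (derivation_inv pos_r d1 f r th Hd1 f_smooth f_neq0 Hr).
  rewrite (d1_d2_commute 0 h r th (Hh 2%nat) Hr).
  unfold d_tan, circle_curv. field. apply f_neq0, Hr.
Qed.

Lemma lap_plus h g r th : SmoothOn pos_r h -> SmoothOn pos_r g -> 0 < r ->
  lap_g f (fun r th => h r th + g r th) r th = lap_g f h r th + lap_g f g r th.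
Proof.
  intros Hh Hg Hr. assert (Hd1 := derivation_d1 pos_r).
  rewrite !lap_frame by (trivial; intros k; apply CkOn_plus; auto).
  rewrite (derivation_plus Hd1 h g), (derivation2_plus Hd1 h g) by trivial.
  rewrite (derivation2_plus derivation_d_tan h g) by trivial. ring.
Qed.

Lemma lap_mult h g r th : SmoothOn pos_r h -> SmoothOn pos_r g -> 0 < r ->
  lap_g f (fun r th => h r th * g r th) r th
  = lap_g f h r th * g r th + 2 * grad_dot f h g r th + h r th * lap_g f g r th.
Proof.
  intros Hh Hg Hr. assert (Hd1 := derivation_d1 pos_r).
  rewrite !lap_frame by (trivial; intros k; apply CkOn_mult; auto).
  rewrite (derivation_mult Hd1 h g), (derivation2_mult Hd1 h g) by trivial.
  rewrite (derivation2_mult derivation_d_tan h g) by trivial.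
  unfold grad_dot. ring.
Qed.

Lemma lap_comp (g g' g'' : R -> R) h r th :
  SmoothOn pos_r h -> SmoothOn pos_r (fun r th => g (h r th)) ->
  SmoothOn pos_r (fun r th => g' (h r th)) ->
  (forall r th, 0 < r -> is_derive g (h r th) (g' (h r th))) ->
  (forall r th, 0 < r -> is_derive g' (h r th) (g'' (h r th))) -> 0 < r ->
  lap_g f (fun r th => g (h r th)) r th
  = g' (h r th) * lap_g f h r th + g'' (h r th) * grad_sq f h r th.
Proof.
  intros Hh Hgh Hg'h Hg Hg' Hr. assert (Hd1 := derivation_d1 pos_r).
  rewrite !lap_frame by trivial.
  rewrite (derivation_comp Hd1 g g' h), (derivation2_comp Hd1 g g' g'' h) by trivial.
  rewrite (derivation2_comp derivation_d_tan g g' g'' h) by trivial.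
  unfold grad_sq, grad_dot. ring.
Qed.

Lemma lap_radial (g g' g'' : R -> R) r th :
  (forall t, 0 < t -> is_derive g t (g' t)) -> is_derive g' r (g'' r) -> 0 < r ->
  lap_g f (fun r _ => g r) r th = g'' r + circle_curv f r th * g' r.
Proof.
  intros Hg Hg' Hr.
  assert (Hd1 : forall r th, 0 < r -> d1 (fun r _ => g r) r th = g' r).
  { intros s t Hs. apply is_derive_unique, Hg, Hs. }
  assert (Hd11 : d1 (d1 (fun r _ => g r)) r th = g'' r).
  { rewrite (d1_ext_on _ (fun r _ => g' r) r th Hd1 Hr). apply is_derive_unique, Hg'. }
  assert (Hd2 : forall c r th, d2 (fun r _ => c r) r th = 0).
  { intros c s t. exact (Derive_const (c s) t). }
  assert (Hd22 : d2 (d2 (fun r _ => g r)) r th = 0).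
  { rewrite (d2_ext_on _ (fun _ _ => 0) r th (fun r th _ => Hd2 g r th) Hr).
    apply (Hd2 (fun _ => 0)). }
  unfold lap_g, circle_curv. rewrite Hd11, Hd1, Hd22, Hd2 by exact Hr. field. apply f_neq0, Hr.
Qed.

(** * Subharmonic functions *)

Lemma strict_max_principle a b B h :
  0 < a <= b -> SmoothOn pos_r h -> periodic_on pos_r h ->
  (forall r th, a < r < b -> 0 < lap_g f h r th) ->
  (forall th, h a th <= B) -> (forall th, h b th <= B) ->
  forall r th, annulus a b r th -> h r th <= B.
Proof.
  intros Hab Hh Hp Hlap Ha Hb r th Hr.
  destruct (annulus_max a b h) as (r0 & th0 & Hr0 & Hmax); [lra | | |].
  { apply (CkOn_subset _ pos_r); [| apply Hh]. intros s t [Hs _]. unfold pos_r. lra. }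
  { intros s t [Hs _]. apply Hp. unfold pos_r. lra. }
  apply Rle_trans with (1 := Hmax r th Hr).
  destruct (Req_dec r0 a) as [-> | Hne_a]; [apply Ha |].
  destruct (Req_dec r0 b) as [-> | Hne_b]; [apply Hb |].
  exfalso. destruct Hr0 as [Har0 Hr0b]. assert (Hr0 : 0 < r0) by lra.
  destruct (local_max_derivatives (fun t => h t th0) (fun t => d1 h t th0) a b r0
    (d1 (d1 h) r0 th0)) as [Hd1 Hd11]; [lra | | | |].
  { intros t Ht. apply (CkOn_is_derive_d1 0 pos_r h t th0 (Hh 1%nat)). unfold pos_r. lra. }
  { apply (CkOn_is_derive_d1 0 pos_r (d1 h)); [apply SmoothOn_d1, Hh | exact Hr0]. }
  { intros t Ht. apply Hmax. split; lra. }
  destruct (local_max_derivatives (fun t => h r0 t) (fun t => d2 h r0 t) (th0 - 1) (th0 + 1) th0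
    (d2 (d2 h) r0 th0)) as [Hd2 Hd22]; [lra | | | |].
  { intros t _. exact (CkOn_is_derive_d2 0 pos_r h r0 t (Hh 1%nat) Hr0). }
  { apply (CkOn_is_derive_d2 0 pos_r (d2 h)); [| exact Hr0].
    apply (derivation_smooth (derivation_d2 pos_r) h Hh). }
  { intros t _. apply Hmax. split; lra. }
  specialize (Hlap r0 th0 ltac:(lra)). unfold lap_g in Hlap. rewrite Hd1, Hd2 in Hlap.
  assert (0 < / f r0 th0 ^ 2) by (apply Rinv_0_lt_compat, pow_lt, f_pos, Hr0). nra.
Qed.

(* [Delta (log w) >= 0] multiplied by [w ^ 2], so that [w] may vanish. *)
Definition log_subharmonic (w : R -> R -> R) : Prop :=
  forall r th, 0 < r ->
    0 <= w r th /\ 0 <= lap_g f w r th /\ grad_sq f w r th <= w r th * lap_g f w r th.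

Lemma log_subharmonic_ln1p w r th :
  SmoothOn pos_r w -> log_subharmonic w -> 0 < r ->
  0 <= lap_g f (fun r th => ln (1 + w r th)) r th.
Proof.
  intros Hw Hlog Hr.
  assert (Hpos : forall s t, 0 < s -> 0 < 1 + w s t).
  { intros s t Hs. destruct (Hlog s t Hs) as [Hw0 _]. lra. }
  assert (Hw1 : SmoothOn pos_r (fun r th => 1 + w r th)).
  { intros k. apply CkOn_plus; [apply (CkOn_const k 1) | apply Hw]. }
  rewrite (lap_comp (fun t => ln (1 + t)) (fun t => / (1 + t)) (fun t => - / (1 + t) ^ 2)); trivial.
  - destruct (Hlog r th Hr) as (Hw0 & Hlap & Hgrad). specialize (Hpos r th Hr).
    replace (_ + _) with (((1 + w r th) * lap_g f w r th - grad_sq f w r th) / (1 + w r th) ^ 2)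
      by (field; lra).
    apply Rdiv_le_0_compat; [lra | apply pow_lt, Hpos].
  - intros k. apply CkOn_ln; [exact Hpos | apply Hw1].
  - intros k. apply CkOn_inv; [| apply Hw1]. intros s t Hs. apply Rgt_not_eq, Hpos, Hs.
  - intros s t Hs. specialize (Hpos s t Hs). auto_derive; [exact Hpos | field; lra].
  - intros s t Hs. specialize (Hpos s t Hs). auto_derive; [lra | field; lra].
Qed.

(** * Nonnegative curvature *)

Hypothesis f_periodic : periodic_on pos_r f.
Hypothesis curv_ge0 : forall r th, 0 < r -> 0 <= gauss_curv f r th.

Lemma circle_curv_le_inv r th : 0 < r -> r * circle_curv f r th <= 1.
Proof.
  intros Hr. assert (Hf := f_pos r th Hr).
  assert (Hslope : r * d1 f r th <= f r th).
  { apply (pos_concave_slope (fun t => f t th) (fun t => d1 f t th)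
      (fun t => d1 (d1 f) t th)); auto.
    - intros t Ht. exact (CkOn_is_derive_d1 0 pos_r f t th (f_smooth 1%nat) Ht).
    - intros t Ht. apply (CkOn_is_derive_d1 0 pos_r); [apply SmoothOn_d1, f_smooth | exact Ht].
    - intros t Ht. assert (HK := curv_ge0 t th Ht). assert (Hft := f_pos t th Ht).
      unfold gauss_curv in HK. apply (Rmult_le_compat_r (f t th)) in HK; [| lra].
      replace (- d1 (d1 f) t th / f t th * f t th) with (- d1 (d1 f) t th) in HK
        by (field; lra).
      lra. }
  unfold circle_curv. apply (Rmult_le_reg_r (f r th)); [exact Hf |].
  replace (r * (d1 f r th * / f r th) * f r th) with (r * d1 f r th) by (field; lra). lra.
Qed.

Lemma SmoothOn_scal_inv_radius c : SmoothOn pos_r (fun r _ => c * / r).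
Proof.
  intros k. apply CkOn_mult; [apply (CkOn_const k c) |].
  apply (CkOn_inv k (fun r _ => r)); [| apply CkOn_fst]. intros r th Hr. apply Rgt_not_eq, Hr.
Qed.

Lemma SmoothOn_scal_ln_radius c : SmoothOn pos_r (fun r _ => c * ln r).
Proof.
  intros k. apply CkOn_mult; [apply (CkOn_const k c) |].
  apply (CkOn_ln k (fun r _ => r)); [auto | apply CkOn_fst].
Qed.

Lemma lap_scal_inv_radius_gt0 c r th :
  0 < c -> 0 < r -> 0 < lap_g f (fun r _ => c * / r) r th.
Proof.
  intros Hc Hr. assert (Hcurv := circle_curv_le_inv r th Hr).
  rewrite (lap_radial (fun t => c * / t) (fun t => c * - / t ^ 2) (fun t => c * (2 / t ^ 3)));
    trivial.
  - replace (_ + _) with (c * / r ^ 3 * (2 - r * circle_curv f r th)) by (field; lra).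
    assert (0 < / r ^ 3) by (apply Rinv_0_lt_compat, pow_lt, Hr).
    repeat apply Rmult_lt_0_compat; lra.
  - intros t Ht. auto_derive; [lra | field; lra].
  - auto_derive; [apply Rgt_not_eq; nra | field; lra].
Qed.

Lemma lap_neg_scal_ln_radius_ge0 c r th :
  0 <= c -> 0 < r -> 0 <= lap_g f (fun r _ => - c * ln r) r th.
Proof.
  intros Hc Hr. assert (Hcurv := circle_curv_le_inv r th Hr).
  rewrite (lap_radial (fun t => - c * ln t) (fun t => - c * / t) (fun t => c * / t ^ 2)); trivial.
  - replace (_ + _) with (c * / r ^ 2 * (1 - r * circle_curv f r th)) by (field; lra).
    assert (0 < / r ^ 2) by (apply Rinv_0_lt_compat, pow_lt, Hr).
    repeat apply Rmult_le_pos; lra.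
  - intros t Ht. auto_derive; [exact Ht | field; lra].
  - auto_derive; [lra | field; lra].
Qed.

Lemma max_principle a b B h :
  0 < a <= b -> SmoothOn pos_r h -> periodic_on pos_r h ->
  (forall r th, a < r < b -> 0 <= lap_g f h r th) ->
  (forall th, h a th <= B) -> (forall th, h b th <= B) ->
  forall r th, annulus a b r th -> h r th <= B.
Proof.
  intros Hab Hh Hp Hlap Ha Hb r th Hr. apply Rle_plus_epsilon. intros eps Heps.
  assert (Hc : 0 < eps * a) by nra.
  assert (Hinv := SmoothOn_scal_inv_radius (eps * a)).
  assert (Hle : forall s, a <= s -> 0 < eps * a * / s <= eps).
  { intros s Hs. split; [apply Rdiv_lt_0_compat; lra |].
    apply Rle_div_l; [| apply Rmult_le_compat_l]; lra. }
  apply Rle_trans with (h r th + eps * a * / r); [destruct Hr; specialize (Hle r); lra |].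
  apply (strict_max_principle a b (B + eps) (fun r th => h r th + eps * a * / r)); trivial.
  - intros k. apply CkOn_plus; [apply Hh | apply Hinv].
  - intros s t Hs. simpl. rewrite Hp by exact Hs. reflexivity.
  - intros s t Hs. assert (Hs0 : 0 < s) by lra.
    rewrite (lap_plus h (fun r _ => eps * a * / r)) by trivial.
    assert (Hstrict := lap_scal_inv_radius_gt0 (eps * a) s t Hc Hs0).
    specialize (Hlap s t Hs). lra.
  - intros t. specialize (Ha t). specialize (Hle a). lra.
  - intros t. specialize (Hb t). specialize (Hle b). lra.
Qed.

Lemma subharmonic_sublogarithmic_bounded A h :
  SmoothOn pos_r h -> periodic_on pos_r h ->
  (forall r th, 1 < r -> 0 <= lap_g f h r th) -> (forall th, h 1 th <= A) ->
  (forall eps r0, 0 < eps -> exists s, r0 < s /\ forall th, h s th <= A + eps * ln s) ->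
  forall r th, 1 <= r -> h r th <= A.
Proof.
  intros Hh Hp Hlap Hunit Hgrowth r th Hr. apply Rle_plus_epsilon. intros eps Heps.
  assert (Hln_r : 0 <= ln r) by (rewrite <- ln_1; apply ln_le; lra).
  set (c := eps / (1 + ln r)).
  assert (Hc : 0 < c) by (apply Rdiv_lt_0_compat; lra).
  assert (Hc_ln : c * ln r <= eps).
  { replace eps with (c * (1 + ln r)) by (unfold c; field; lra). lra. }
  destruct (Hgrowth c r Hc) as (s & Hrs & Hs).
  assert (Hln := SmoothOn_scal_ln_radius (- c)).
  assert (h r th + - c * ln r <= A); [| lra].
  apply (max_principle 1 s A (fun r th => h r th + - c * ln r)); [lra | | | | | | split; lra].
  - intros k. apply CkOn_plus; [apply Hh | apply Hln].
  - intros q t Hq. simpl. rewrite Hp by exact Hq. reflexivity.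
  - intros q t Hq. assert (Hq0 : 0 < q) by lra.
    rewrite (lap_plus h (fun r _ => - c * ln r)) by trivial.
    assert (Hsuper := lap_neg_scal_ln_radius_ge0 c q t (Rlt_le _ _ Hc) Hq0).
    specialize (Hlap q t ltac:(lra)). lra.
  - intros t. rewrite ln_1. specialize (Hunit t). lra.
  - intros t. specialize (Hs t). lra.
Qed.

(** * The Bochner formula *)

Section HarmonicFunction.

Variable v : R -> R -> R.
Hypothesis v_smooth : SmoothOn pos_r v.
Hypothesis v_periodic : periodic_on pos_r v.
Hypothesis v_harmonic : forall r th, 0 < r -> lap_g f v r th = 0.

Lemma gradient_div_free r th : 0 < r ->
  d_tan f (d_tan f v) r th = - (d1 (d1 v) r th + circle_curv f r th * d1 v r th).
Proof.
  intros Hr. assert (Hlap := v_harmonic r th Hr). rewrite lap_frame in Hlap by assumption. lra.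
Qed.

Lemma gradient_curl_free r th : 0 < r ->
  d_tan f (d1 v) r th = d1 (d_tan f v) r th + circle_curv f r th * d_tan f v r th.
Proof. intros Hr. rewrite frame_commutator by assumption. ring. Qed.

Lemma derivation_div_free X r th : derivation pos_r X -> 0 < r ->
  X (d_tan f (d_tan f v)) r th
  = - (X (d1 (d1 v)) r th + X (circle_curv f) r th * d1 v r th
       + circle_curv f r th * X (d1 v) r th).
Proof.
  intros HX Hr.
  assert (Ha := SmoothOn_d1 v v_smooth). assert (Hk := SmoothOn_circle_curv).
  assert (Hka : SmoothOn pos_r (fun r th => circle_curv f r th * d1 v r th)).
  { intros n. apply CkOn_mult; auto. }
  assert (Hda := SmoothOn_d1 _ Ha).
  rewrite (derivation_ext HX _ _ gradient_div_free r th Hr).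
  rewrite (derivation_comp HX Ropp (fun _ => -1)
    (fun r th => d1 (d1 v) r th + circle_curv f r th * d1 v r th)); trivial.
  - rewrite (derivation_plus HX (d1 (d1 v))), (derivation_mult HX (circle_curv f)) by trivial.
    ring.
  - intros n. apply CkOn_plus; auto.
  - intros s t _. auto_derive; [exact I | ring].
Qed.

Lemma derivation_curl_free X r th : derivation pos_r X -> 0 < r ->
  X (d_tan f (d1 v)) r th
  = X (d1 (d_tan f v)) r th + X (circle_curv f) r th * d_tan f v r th
    + circle_curv f r th * X (d_tan f v) r th.
Proof.
  intros HX Hr.
  assert (Hb := SmoothOn_d_tan v v_smooth). assert (Hk := SmoothOn_circle_curv).
  rewrite (derivation_ext HX _ _ gradient_curl_free r th Hr).
  rewrite (derivation_plus HX (d1 (d_tan f v))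
    (fun r th => circle_curv f r th * d_tan f v r th)); trivial.
  - rewrite (derivation_mult HX (circle_curv f)) by trivial. ring.
  - apply SmoothOn_d1, Hb.
  - intros n. apply CkOn_mult; auto.
Qed.

Lemma lap_d1_harmonic r th : 0 < r ->
  lap_g f (d1 v) r th
  = (gauss_curv f r th + circle_curv f r th ^ 2) * d1 v r th
    + 2 * circle_curv f r th * d_tan f (d_tan f v) r th
    + d_tan f (circle_curv f) r th * d_tan f v r th.
Proof.
  intros Hr.
  assert (Ha := SmoothOn_d1 v v_smooth). assert (Hb := SmoothOn_d_tan v v_smooth).
  assert (Hdiv := derivation_div_free d1 r th (derivation_d1 pos_r) Hr).
  assert (Hcurl := derivation_curl_free (d_tan f) r th derivation_d_tan Hr).
  rewrite frame_commutator in Hdiv by trivial. rewrite riccati_circle_curv in Hdiv by exact Hr.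
  rewrite lap_frame by trivial. lra.
Qed.

Lemma lap_d_tan_harmonic r th : 0 < r ->
  lap_g f (d_tan f v) r th
  = (gauss_curv f r th + circle_curv f r th ^ 2) * d_tan f v r th
    - 2 * circle_curv f r th * d_tan f (d1 v) r th
    - d_tan f (circle_curv f) r th * d1 v r th.
Proof.
  intros Hr.
  assert (Ha := SmoothOn_d1 v v_smooth). assert (Hb := SmoothOn_d_tan v v_smooth).
  assert (Hdiv := derivation_div_free (d_tan f) r th derivation_d_tan Hr).
  assert (Hcurl := derivation_curl_free d1 r th (derivation_d1 pos_r) Hr).
  rewrite frame_commutator in Hcurl by trivial. rewrite riccati_circle_curv in Hcurl by exact Hr.
  rewrite lap_frame by trivial. lra.
Qed.

(* The Hessian of a harmonic function is symmetric and trace-free, so its square is the scalar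
   [hessian_sq]; [grad_sq_grad_sq] then holds because [grad |grad v|^2 = 2 Hess v (grad v)]. *)
Definition hessian_sq (r th : R) : R := d1 (d1 v) r th ^ 2 + d1 (d_tan f v) r th ^ 2.

Lemma bochner r th : 0 < r ->
  lap_g f (grad_sq f v) r th
  = 4 * hessian_sq r th + 2 * gauss_curv f r th * grad_sq f v r th.
Proof.
  intros Hr.
  assert (Ha := SmoothOn_d1 v v_smooth). assert (Hb := SmoothOn_d_tan v v_smooth).
  unfold grad_sq at 1. unfold grad_dot at 1.
  rewrite (lap_plus (fun r th => d1 v r th * d1 v r th)
    (fun r th => d_tan f v r th * d_tan f v r th))
    by (trivial; intros n; apply CkOn_mult; auto).
  rewrite !lap_mult, lap_d1_harmonic, lap_d_tan_harmonic by trivial.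
  unfold grad_sq, grad_dot, hessian_sq.
  rewrite gradient_div_free, gradient_curl_free by exact Hr. ring.
Qed.

Lemma grad_sq_grad_sq r th : 0 < r ->
  grad_sq f (grad_sq f v) r th = 4 * grad_sq f v r th * hessian_sq r th.
Proof.
  intros Hr.
  assert (Ha := SmoothOn_d1 v v_smooth). assert (Hb := SmoothOn_d_tan v v_smooth).
  assert (Hderiv : forall X, derivation pos_r X -> X (grad_sq f v) r th
    = 2 * (d1 v r th * X (d1 v) r th + d_tan f v r th * X (d_tan f v) r th)).
  { intros X HX. unfold grad_sq, grad_dot.
    rewrite (derivation_plus HX (fun r th => d1 v r th * d1 v r th)
      (fun r th => d_tan f v r th * d_tan f v r th))
      by (trivial; intros n; apply CkOn_mult; auto).
    rewrite !(derivation_mult HX) by trivial. ring. }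
  unfold grad_sq at 1. unfold grad_dot.
  rewrite (Hderiv d1 (derivation_d1 pos_r)), (Hderiv (d_tan f) derivation_d_tan).
  rewrite gradient_div_free, gradient_curl_free by exact Hr.
  unfold grad_sq, grad_dot, hessian_sq. ring.
Qed.

Lemma grad_sq_log_subharmonic : log_subharmonic (grad_sq f v).
Proof.
  intros r th Hr.
  assert (Hw := grad_sq_ge0 f v r th). assert (HK := curv_ge0 r th Hr).
  assert (Hhess : 0 <= hessian_sq r th) by (unfold hessian_sq; nra).
  rewrite bochner, grad_sq_grad_sq by exact Hr.
  assert (0 <= gauss_curv f r th * grad_sq f v r th) by (apply Rmult_le_pos; assumption).
  split; [exact Hw | split; nra].
Qed.

Lemma grad_sq_periodic : periodic_on pos_r (grad_sq f v).
Proof.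
  intros r th Hr. unfold grad_sq, grad_dot, d_tan.
  rewrite (periodic_on_d1 v v_periodic r th Hr), (periodic_on_d2 v v_periodic r th Hr).
  rewrite (f_periodic r th Hr). reflexivity.
Qed.

(** * Bernstein's gradient estimate *)

Definition bernstein (s r th : R) : R :=
  (1 - (r / s) ^ 2) ^ 2 * grad_sq f v r th + (2 / s * v r th) ^ 2.

Lemma SmoothOn_cutoff s : SmoothOn pos_r (fun r _ => (1 - (r / s) ^ 2) ^ 2).
Proof.
  intros k. apply (CkOn_ext k (fun r _ => (1 + -1 * (r * / s) ^ 2) ^ 2)).
  { intros r th _. unfold Rdiv. ring. }
  apply (CkOn_pow k 2 (fun r _ => 1 + -1 * (r * / s) ^ 2)).
  apply CkOn_plus; [apply (CkOn_const k 1) |].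
  apply CkOn_mult; [apply (CkOn_const k (-1)) |].
  apply (CkOn_pow k 2 (fun r _ => r * / s)).
  apply CkOn_mult; [apply CkOn_fst | apply (CkOn_const k (/ s))].
Qed.

Lemma SmoothOn_scaled_sqr c : SmoothOn pos_r (fun r th => (c * v r th) ^ 2).
Proof.
  intros k. apply (CkOn_pow k 2 (fun r th => c * v r th)).
  apply CkOn_mult; [apply (CkOn_const k c) | apply v_smooth].
Qed.

Lemma SmoothOn_bernstein s : SmoothOn pos_r (bernstein s).
Proof.
  intros k. apply CkOn_plus; [| apply SmoothOn_scaled_sqr].
  apply CkOn_mult; [apply SmoothOn_cutoff | apply SmoothOn_grad_sq, v_smooth].
Qed.

Lemma lap_cutoff s r th : s <> 0 -> 0 < r ->
  lap_g f (fun r _ => (1 - (r / s) ^ 2) ^ 2) r th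
  = - 4 / s ^ 2 * (1 - (r / s) ^ 2) * (1 + r * circle_curv f r th) + 8 * r ^ 2 / s ^ 4.
Proof.
  intros Hs Hr.
  rewrite (lap_radial (fun t => (1 - (t / s) ^ 2) ^ 2)
    (fun t => - 4 * t / s ^ 2 * (1 - (t / s) ^ 2))
    (fun t => - 4 / s ^ 2 * (1 - (t / s) ^ 2) + 8 * t ^ 2 / s ^ 4)); trivial.
  - field. exact Hs.
  - intros t _. auto_derive; [exact I | field; exact Hs].
  - auto_derive; [exact I | field; exact Hs].
Qed.

Lemma lap_scaled_sqr c r th : 0 < r ->
  lap_g f (fun r th => (c * v r th) ^ 2) r th = 2 * c ^ 2 * grad_sq f v r th.
Proof.
  intros Hr.
  rewrite (lap_comp (fun t => (c * t) ^ 2) (fun t => 2 * c ^ 2 * t) (fun _ => 2 * c ^ 2)); trivial.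
  - rewrite v_harmonic by exact Hr. ring.
  - apply SmoothOn_scaled_sqr.
  - intros k. apply CkOn_mult; [apply (CkOn_const k (2 * c ^ 2)) | apply v_smooth].
  - intros s t _. auto_derive; [exact I | ring].
  - intros s t _. auto_derive; [exact I | ring].
Qed.

Lemma grad_dot_radial (g g' : R -> R) h r th :
  (forall t, 0 < t -> is_derive g t (g' t)) -> 0 < r ->
  grad_dot f (fun r _ => g r) h r th = g' r * d1 h r th.
Proof.
  intros Hg Hr. unfold grad_dot, d_tan.
  replace (d1 (fun r _ => g r) r th) with (g' r) by (symmetry; apply is_derive_unique, Hg, Hr).
  replace (d2 (fun r _ => g r) r th) with 0 by (symmetry; exact (Derive_const (g r) th)). ring.
Qed.

Lemma bernstein_subharmonic s r th : 0 < r < s -> 0 <= lap_g f (bernstein s) r th.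
Proof.
  intros [Hr Hrs].
  assert (Hw := SmoothOn_grad_sq v v_smooth). unfold bernstein.
  rewrite (lap_plus (fun r th => (1 - (r / s) ^ 2) ^ 2 * grad_sq f v r th)
    (fun r th => (2 / s * v r th) ^ 2)); [| | apply SmoothOn_scaled_sqr | exact Hr].
  2: { intros k. apply CkOn_mult; [apply SmoothOn_cutoff | apply Hw]. }
  rewrite (lap_mult (fun r _ => (1 - (r / s) ^ 2) ^ 2)) by (trivial; apply SmoothOn_cutoff).
  rewrite lap_cutoff, lap_scaled_sqr by lra.
  rewrite (grad_dot_radial (fun r => (1 - (r / s) ^ 2) ^ 2)
    (fun t => - 4 * t / s ^ 2 * (1 - (t / s) ^ 2)));
    [| intros t _; auto_derive; [exact I | field; lra] | exact Hr].
  destruct (grad_sq_log_subharmonic r th Hr) as (Hw0 & Hlap & Hgrad).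
  set (w := grad_sq f v r th) in *. set (lw := lap_g f (grad_sq f v) r th) in *.
  set (w_r := d1 (grad_sq f v) r th). set (phi := 1 - (r / s) ^ 2).
  assert (Hphi : 0 <= phi).
  { assert (0 <= r / s <= 1); [| unfold phi; nra].
    split; [apply Rdiv_le_0_compat; lra |]. apply Rle_div_l; lra. }
  (* Kato's inequality lets [lap w] absorb the cross term [grad (phi ^ 2) . grad w]. *)
  assert (Hform : 0 <= lw * phi ^ 2 + 2 * - w_r * (phi * (4 * r / s ^ 2))
    + w * (4 * r / s ^ 2) ^ 2).
  { apply quadratic_form_ge0; trivial. unfold grad_sq at 1, grad_dot in Hgrad. fold w_r in Hgrad.
    nra. }
  assert (Hcurv := circle_curv_le_inv r th Hr).
  assert (Hrest : 0 <= 4 / s ^ 2 * phi * (1 - r * circle_curv f r th) * w).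
  { repeat apply Rmult_le_pos; try lra. apply Rlt_le, Rinv_0_lt_compat, pow_lt. lra. }
  replace (_ + _) with ((lw * phi ^ 2 + 2 * - w_r * (phi * (4 * r / s ^ 2))
    + w * (4 * r / s ^ 2) ^ 2) + 4 / s ^ 2 * phi * (1 - r * circle_curv f r th) * w); [lra |].
  unfold phi. field. lra.
Qed.

Lemma bernstein_gradient_estimate s N M1 M :
  2 <= s -> (forall th, grad_sq f v 1 th <= N) -> (forall th, Rabs (v 1 th) <= M1) ->
  (forall th, Rabs (v s th) <= M) ->
  forall th, grad_sq f v (s / 2) th <= 2 * (N + M1 ^ 2 + 4 * (M / s) ^ 2).
Proof.
  intros Hs HN HM1 HM th.
  assert (Hsqr : forall x y, Rabs x <= y -> x ^ 2 <= y ^ 2).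
  { intros x y Hxy. rewrite <- (pow2_abs x). apply pow_incr. split; [apply Rabs_pos | exact Hxy]. }
  assert (Hinv : 0 <= (2 / s) ^ 2 <= 1).
  { assert (0 <= 2 / s <= 1); [| split; nra].
    split; [apply Rdiv_le_0_compat; lra |]. apply Rle_div_l; lra. }
  assert (HN0 : 0 <= N) by (apply Rle_trans with (2 := HN 0); apply grad_sq_ge0).
  assert (HB : bernstein s (s / 2) th <= N + M1 ^ 2 + 4 * (M / s) ^ 2).
  { apply (max_principle 1 s); [lra | apply SmoothOn_bernstein | | | | | split; lra].
    - intros r t Hr. unfold bernstein.
      rewrite grad_sq_periodic, v_periodic by exact Hr. reflexivity.
    - intros r t Hr. apply bernstein_subharmonic. lra.
    - intros t. unfold bernstein. assert (Hw := grad_sq_ge0 f v 1 t).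
      assert (Hcut : 0 <= (1 - (1 / s) ^ 2) ^ 2 <= 1).
      { replace ((1 / s) ^ 2) with ((2 / s) ^ 2 / 4) by (field; lra). split; nra. }
      assert (Hv := Hsqr _ _ (HM1 t)).
      assert ((2 / s * v 1 t) ^ 2 <= v 1 t ^ 2).
      { rewrite Rpow_mult_distr. nra. }
      specialize (HN t). nra.
    - intros t. unfold bernstein. assert (Hv := Hsqr _ _ (HM t)).
      replace (s / s) with 1 by (field; lra).
      replace ((2 / s * v s t) ^ 2) with (4 * (v s t ^ 2 / s ^ 2)) by (field; lra).
      replace ((M / s) ^ 2) with (M ^ 2 / s ^ 2) by (field; lra).
      assert (v s t ^ 2 / s ^ 2 <= M ^ 2 / s ^ 2).
      { apply Rmult_le_compat_r; [| exact Hv]. apply Rlt_le, Rinv_0_lt_compat, pow_lt. lra. }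
      assert (HM1' := pow2_ge_0 M1). nra. }
  unfold bernstein in HB. replace (s / 2 / s) with (/ 2) in HB by (field; lra).
  assert (Hw := grad_sq_ge0 f v (s / 2) th).
  assert (Hv := pow2_ge_0 (2 / s * v (s / 2) th)). nra.
Qed.

Lemma log_gradient_estimate s delta N M :
  4 <= s -> 0 < delta -> (forall th, grad_sq f v 1 th <= N) -> (forall th, Rabs (v 1 th) <= M) ->
  (forall th, Rabs (v s th) <= Rpower s (1 + delta)) ->
  forall th, ln (1 + grad_sq f v (s / 2) th) <= ln (9 + 2 * N + 2 * M ^ 2) + 4 * delta * ln (s / 2).
Proof.
  intros Hs Hdelta HN HM Hvs th.
  assert (HN0 : 0 <= N) by (apply Rle_trans with (2 := HN 0); apply grad_sq_ge0).
  assert (HM2 := pow2_ge_0 M). assert (Hw := grad_sq_ge0 f v (s / 2) th).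
  assert (Hest := bernstein_gradient_estimate s N M _ ltac:(lra) HN HM Hvs th).
  assert (Hratio := Rpower_div_self_sqr_le s delta Hs (Rlt_le _ _ Hdelta)).
  assert (Hone : 1 <= Rpower (s / 2) (4 * delta)).
  { rewrite <- (Rpower_O (s / 2)) by lra. apply Rle_Rpower; lra. }
  rewrite <- (ln_exp (4 * delta * ln (s / 2))). fold (Rpower (s / 2) (4 * delta)).
  rewrite <- ln_mult by lra. apply ln_le; nra.
Qed.

Lemma harmonic_gradient_bounded :
  (forall delta r0, 0 < delta ->
    exists s, r0 < s /\ forall th, Rabs (v s th) <= Rpower s (1 + delta)) ->
  exists C, forall r th, 1 <= r -> grad_sq f v r th <= C.
Proof.
  intros Hgrowth. assert (Hw := SmoothOn_grad_sq v v_smooth).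
  assert (Hunit : forall r th, annulus 1 1 r th -> pos_r r th).
  { intros r th [Hr _]. unfold pos_r. lra. }
  destruct (annulus_bounded 1 1 (grad_sq f v)) as (N & HN0 & HN).
  { apply CkOn_subset with (1 := Hunit), (Hw 0%nat). }
  { intros r th Hr. apply grad_sq_periodic, (Hunit r th), Hr. }
  destruct (annulus_bounded 1 1 v) as (M & _ & HM).
  { apply CkOn_subset with (1 := Hunit), (v_smooth 0%nat). }
  { intros r th Hr. apply v_periodic, (Hunit r th), Hr. }
  assert (HN1 : forall th, grad_sq f v 1 th <= N).
  { intros th. apply Rle_trans with (1 := Rle_abs _), HN. split; lra. }
  assert (HM1 : forall th, Rabs (v 1 th) <= M) by (intros th; apply HM; split; lra).
  set (K := 9 + 2 * N + 2 * M ^ 2). assert (HM2 := pow2_ge_0 M).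
  assert (Hw0 : forall r th, 0 < 1 + grad_sq f v r th).
  { intros r th. generalize (grad_sq_ge0 f v r th). lra. }
  assert (Hln : forall r th, 1 <= r -> ln (1 + grad_sq f v r th) <= ln K).
  { apply subharmonic_sublogarithmic_bounded with (h := fun r th => ln (1 + grad_sq f v r th)).
    - intros k. apply CkOn_ln; [intros; apply Hw0 |].
      apply CkOn_plus; [apply (CkOn_const k 1) | apply Hw].
    - intros s t Hs. simpl. rewrite grad_sq_periodic by exact Hs. reflexivity.
    - intros s t Hs. apply log_subharmonic_ln1p; [exact Hw | exact grad_sq_log_subharmonic | lra].
    - intros t. apply ln_le; [apply Hw0 |]. specialize (HN1 t). unfold K. lra.
    - intros eps r0 Heps. assert (Hmax_l := Rmax_l 2 r0). assert (Hmax_r := Rmax_r 2 r0).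
      destruct (Hgrowth (eps / 4) (2 * Rmax 2 r0)) as (s & Hs & Hvs); [lra |].
      exists (s / 2). split; [lra |]. intros t.
      replace eps with (4 * (eps / 4)) by field. apply log_gradient_estimate; trivial; lra. }
  exists K. intros r th Hr. apply Rle_trans with (1 + grad_sq f v r th); [lra |].
  apply Rnot_lt_le. intros Hlt. apply ln_increasing in Hlt; [| unfold K; lra].
  specialize (Hln r th Hr). lra.
Qed.

End HarmonicFunction.

End WarpedMetric.

Lemma linear_growth_of_gradient_bound f v C :
  CkOn 0 (annulus 0 1) v -> periodic_on (annulus 0 1) v -> SmoothOn pos_r v ->
  (forall r th, 1 <= r -> grad_sq f v r th <= C) ->
  exists L, 0 < L /\ forall r th, 0 <= r -> Rabs (v r th) <= L * (1 + r).
Proof.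
  intros Hc Hp Hv HC.
  destruct (annulus_bounded 0 1 v Hc Hp) as (M & HM0 & HM).
  assert (Hd1 : forall r th, 1 <= r -> Rabs (d1 v r th) <= sqrt C).
  { intros r th Hr. rewrite <- sqrt_Rsqr_abs. apply sqrt_le_1_alt.
    apply Rle_trans with (2 := HC r th Hr). unfold grad_sq, grad_dot, Rsqr. nra. }
  assert (HC0 := sqrt_pos C).
  exists (1 + M + sqrt C). split; [lra |]. intros r th Hr.
  destruct (Rle_lt_dec r 1) as [Hr1 | Hr1].
  { assert (Hb := HM r th (conj Hr Hr1)). nra. }
  destruct (MVT_cor2 (fun t => v t th) (fun t => d1 v t th) 1 r Hr1) as (c & Hincr & Hc1).
  { intros t Ht. apply is_derive_Reals.
    apply (CkOn_is_derive_d1 0 pos_r v t th (Hv 1%nat)). unfold pos_r. lra. }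
  assert (Hb := HM 1 th ltac:(split; lra)).
  assert (Hdiff : Rabs (v r th - v 1 th) <= sqrt C * (r - 1)).
  { rewrite Hincr, Rabs_mult, (Rabs_pos_eq (r - 1)) by lra.
    apply Rmult_le_compat_r; [lra | apply Hd1; lra]. }
  assert (Htriangle := Rabs_triang (v r th - v 1 th) (v 1 th)).
  replace (v r th - v 1 th + v 1 th) with (v r th) in Htriangle by ring. nra.
Qed.

Lemma SmoothOn_polar u : SmoothOn whole_plane u -> SmoothOn whole_plane (polar u).
Proof.
  intros Hu k.
  destruct (CkOn_cos_sin k (fun _ th => th) (CkOn_snd (D := whole_plane) k))
    as [Hcos Hsin].
  apply (CkOn_comp_2d k whole_plane whole_plane u
    (fun r th => r * cos th) (fun r th => r * sin th));
    [intros; exact I | apply Hu | |]; apply CkOn_mult; trivial; apply CkOn_fst.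
Qed.

Lemma periodic_on_polar D u : periodic_on D (polar u).
Proof.
  intros r th _. unfold polar.
  rewrite cos_plus, sin_plus, cos_2PI, sin_2PI. f_equal; ring.
Qed.

Lemma liminf_zero_frequently_below h g :
  (forall r, 0 < g r) -> liminf_pinfty_eq (fun r => h r / g r) 0 ->
  forall r0, exists r, r0 < r /\ h r <= g r.
Proof.
  intros Hg [_ Hlim] r0. destruct (Hlim 1 Rlt_0_1 r0) as (r & Hr & Hlt).
  exists r. split; [exact Hr |].
  apply Rlt_le. rewrite <- (Rmult_1_l (g r)). apply Rlt_div_l; [apply Hg | lra].
Qed.

Theorem theorem4 (f u : R -> R -> R) :
  polar_metric_fun f ->
  (forall r th, 0 < r -> 0 <= gauss_curv f r th) ->
  SmoothOn whole_plane u ->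
  (forall r th, 0 < r -> lap_g f (polar u) r th = 0) ->
  (forall delta, 0 < delta ->
     liminf_pinfty_eq (fun r => Mmax (polar u) r / Rpower r (1 + delta)) 0) ->
  exists C, 0 < C /\ forall r th, 0 <= r -> Rabs (polar u r th) <= C * (1 + r).
Proof.
  intros (Hf & Hpos & Hper & _ & _) HK Hu Hlap Hgrowth.
  assert (Hv : forall D, SmoothOn D (polar u)).
  { intros D k. apply (CkOn_subset D whole_plane); [intros; exact I | apply SmoothOn_polar, Hu]. }
  destruct (harmonic_gradient_bounded f Hf Hpos Hper HK (polar u)) as [C HC].
  - apply Hv.
  - apply periodic_on_polar.
  - exact Hlap.
  - intros delta r0 Hdelta.
    destruct (liminf_zero_frequently_below (Mmax (polar u)) (fun r => Rpower r (1 + delta))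
      (fun r => exp_pos _) (Hgrowth delta Hdelta) r0) as (s & Hs & Hle).
    exists s. split; [exact Hs |]. intros th. apply Rle_trans with (2 := Hle).
    apply Mmax_ge; [apply (Hv _ 0%nat) | apply periodic_on_polar].
  - apply (linear_growth_of_gradient_bound f (polar u) C).
    + apply (Hv _ 0%nat).
    + apply periodic_on_polar.
    + apply Hv.
    + exact HC.
Qed.
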